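(* Let $\psi:E_k\to E_k$ be a vector function all of whose first order partial derivatives exist and are continuous, and let $\psi_0(\eta)=\eta$, $\psi_n(\eta)=\psi(\psi_{n-1}(\eta))$ for $n\in\mathbb{N}$. If $\det[J_\eta(\psi)]$ has a root at the point $\eta=X$, then, for every $n\in\mathbb{N}$, $\det[J_\eta(\psi_n)]$ has a root at the point $\eta=X$ too.
   Context: $E_k$ ($k\ge1$) denotes $\mathbb{R}^k$; $\mathbb{N}$ is the set of positive integers. $J_\eta(f)$ denotes the Jacobian matrix of $f$ at $\eta$. *)

(* Defs.v *)
From HB Require Import structures.
From mathcomp Require Import all_boot all_order all_algebra.
From mathcomp Require Import all_classical all_reals all_analysis.

Set Implicit Arguments.
Unset Strict Implicit.
Unset Printing Implicit Defensive.

Import Order.TTheory GRing.Theory Num.Theory.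
Import numFieldNormedType.Exports.

Local Open Scope ring_scope.

(* The partial derivative of the i-th component of f with respect to the j-th
   variable is the directional derivative along the basis vector
   [delta_mx 0 j]. Both [derivable] and ['D_v] are two-sided limits in the
   scalar parameter only, so existence of the partial derivatives does not
   presuppose Frechet differentiability of f. *)
Definition component (R : realType) (m n : nat)
    (f : 'rV[R]_m -> 'rV[R]_n) (i : 'I_n) : 'rV[R]_m -> R :=
  fun x => f x 0 i.

Definition continuous_partials (R : realType) (m n : nat)
    (f : 'rV[R]_m -> 'rV[R]_n) : Prop :=
  forall (i : 'I_n) (j : 'I_m),
    (forall x, derivable (component f i) x (delta_mx 0 j)) /\
    continuous (fun x => 'D_(delta_mx 0 j) (component f i) x).

(* ['J f x] is the matrix of the differential of f acting on row vectors, that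
   is the transpose of the matrix (d f_i / d x_j)_(i, j), which has the same
   determinant. It is meaningful only where f is differentiable, so
   differentiability is part of what it means for the Jacobian determinant
   to have a root. *)
Definition det_jacobian_root (R : realType) (k : nat)
    (f : 'rV[R]_k -> 'rV[R]_k) (x : 'rV[R]_k) : Prop :=
  differentiable f x /\ \det ('J f x) = 0.

(* Main.v *)
From HB Require Import structures.
Require Import Defs.
From mathcomp Require Import all_boot all_order all_algebra.
From mathcomp Require Import all_classical all_reals all_analysis.
Import Order.TTheory GRing.Theory Num.Theory.
Import numFieldNormedType.Exports.
Local Open Scope ring_scope.

(** The two analytic facts behind the statement are that a map with continuous
    partial derivatives is Frechet differentiable, and the chain rule.

    For the first, it is enough to treat one real-valued component [g]. The
    increment [g (x + h) - g x] is telescoped along the path that switches on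
    the coordinates of [h] one after the other; each piece moves along a single
    axis, so the mean value theorem rewrites it as [h_j] times a partial
    derivative taken at a point at distance at most [`|h|] from [x]
    ([derive_mvt], [norm_prefix_row]). Continuity of the partial derivatives at
    [x] then turns the sum into [\sum_j h_j * (d g / d x_j) x + o(h)]
    ([differentiable_of_partials]).

    Hence [psi] and all its iterates are differentiable. Writing
    [iter n.+1 psi] as [iter n psi \o psi], so that [psi] is applied first,
    the chain rule makes the Jacobian matrix of [psi] at [X] itself a factor of
    the Jacobian matrix of the iterate at [X], and the determinant is
    multiplicative. *)

(** * Norms of row vectors *)

Lemma norm_coord_le {R : realType} {m : nat} (v : 'rV[R]_m) (i : 'I_m) :
  `|v 0 i| <= `|v|.
Proof.
rewrite [leRHS]/Num.norm /= mx_normrE.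
exact: (le_bigmax _ (fun ij : 'I_1 * 'I_m => `|v ij.1 ij.2|) (0, i)).
Qed.

Lemma norm_rV_le {R : realType} {m : nat} (v : 'rV[R]_m) (e : R) :
  0 <= e -> (forall i, `|v 0 i| <= e) -> `|v| <= e.
Proof.
move=> e0 ve; rewrite [leLHS]/Num.norm /= mx_normrE.
by apply/bigmax_leP; split => // -[i j] _ /=; rewrite ord1.
Qed.

(** * The mean value theorem along a direction *)

(** The scalar [t] may be negative, which is why the intermediate point is
    located by a bound on [`|c|] and not by an interval. *)
Lemma derive_mvt {R : realType} {V : normedModType R} (g : V -> R) (y v : V)
    (t : R) :
  (forall z, derivable g z v) ->
  exists2 c, `|c| <= `|t| & g (y + t *: v) - g y = t * 'D_v g (y + c *: v).
Proof.
move=> dg; pose phi (s : R) : R := g (y + s *: v).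
(* The difference quotients of phi at s along 1 and of g along v coincide, so
   the derivative of phi is a directional derivative of g. *)
have quotE (s : R) : (fun h => h^-1 *: ((phi \o shift s) (h *: 1) - phi s)) =
    (fun h => h^-1 *: ((g \o shift (y + s *: v)) (h *: v) - g (y + s *: v))).
  apply/funext => h /=; congr (_ *: (g _ - _)).
  by rewrite [h%:A]mulr1 scalerDl addrCA.
have dphi (s : R) : is_derive s (1 : R) phi ('D_v g (y + s *: v)).
  split; first by rewrite /derivable quotE; exact: dg.
  by rewrite /derive quotE.
have cphi (a b : R) : {within `[a, b], continuous phi}%classic.
  apply: derivable_within_continuous => s _; exact: ex_derive.
have phi0 : phi 0 = g y by rewrite /phi scale0r addr0.
rewrite -/(phi t) -phi0.
have [t0|t0] := leP 0 t.
  have [c /itvP cI ->] := MVT_segment t0 (fun s _ => dphi s) (cphi 0 t).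
  exists c; last by rewrite subr0 mulrC.
  by rewrite !ger0_norm ?cI.
have [c /itvP cI E] := MVT_segment (ltW t0) (fun s _ => dphi s) (cphi t 0).
exists c; last by rewrite -opprB E sub0r mulrN opprK mulrC.
by rewrite !ler0_norm ?cI ?lerN2 ?cI// ltW.
Qed.

(** * Continuous partial derivatives imply differentiability *)

Definition prefix_row {R : realType} {m : nat} (j : nat) (h : 'rV[R]_m) :
    'rV[R]_m :=
  \row_i (if (i < j)%N then h 0 i else 0).

Lemma prefix_row0 {R : realType} {m : nat} (h : 'rV[R]_m) :
  prefix_row 0 h = 0.
Proof. by apply/rowP => i; rewrite !mxE ltn0. Qed.

Lemma prefix_row_full {R : realType} {m : nat} (h : 'rV[R]_m) :
  prefix_row m h = h.
Proof. by apply/rowP => i; rewrite !mxE ltn_ord. Qed.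

Lemma prefix_rowS {R : realType} {m : nat} (h : 'rV[R]_m) (j : 'I_m) :
  prefix_row j.+1 h = prefix_row j h + h 0 j *: delta_mx 0 j.
Proof.
apply/rowP => i; rewrite !mxE ltnS leq_eqVlt eqxx /=.
have [->|ij] := eqVneq i j; first by rewrite eqxx ltnn mulr1 add0r.
by rewrite (negbTE ij : (val i == val j) = false) mulr0 addr0.
Qed.

(** Coordinate [j] of [prefix_row j h] is zero, so the two summands have
    disjoint supports and the maximum norm of their sum is still at most
    [`|h|]. *)
Lemma norm_prefix_row {R : realType} {m : nat} (h : 'rV[R]_m) (j : 'I_m)
    (c : R) :
  `|c| <= `|h 0 j| -> `|prefix_row j h + c *: delta_mx 0 j| <= `|h|.
Proof.
move=> cj; apply: norm_rV_le => // i; rewrite !mxE eqxx /=.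
have [->|ij] := eqVneq i j.
  by rewrite ltnn mulr1 add0r (le_trans cj)// norm_coord_le.
by rewrite mulr0 addr0; case: ifP => _; rewrite ?normr0// norm_coord_le.
Qed.

Lemma dot_is_linear {R : realType} {m : nat} (c : 'I_m -> R) :
  linear (fun h : 'rV[R]_m => \sum_(j < m) h 0 j * c j).
Proof.
move=> a u v; rewrite scaler_sumr -big_split /=; apply: eq_bigr => j _.
by rewrite !mxE mulrDl -mulrA.
Qed.

Lemma dot_continuous {R : realType} {m : nat} (c : 'I_m -> R) :
  continuous (fun h : 'rV[R]_m => \sum_(j < m) h 0 j * c j).
Proof.
apply: continuous_big => [|j _]; first exact: add_continuous.
move=> x; apply: cvgMr_tmp; [exact: (nbhs_filter x)|exact: coord_continuous].
Qed.

(** Every intermediate point produced by the mean value theorem lies within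
    [`|h|] of [x], so continuity of the partial derivatives at the single point
    [x] controls all of them; off [x] only their existence matters. *)
Lemma differentiable_of_partials {R : realType} {m : nat} (g : 'rV[R]_m -> R)
    (x : 'rV[R]_m) :
  (forall (j : 'I_m) z, derivable g z (delta_mx 0 j)) ->
  (forall j : 'I_m, {for x, continuous (fun z => 'D_(delta_mx 0 j) g z)}) ->
  differentiable g x.
Proof.
move=> dg cg; pose c j := 'D_(delta_mx 0 j) g x.
pose L := fun h : 'rV[R]_m => \sum_(j < m) h 0 j * c j.
pose dfM := GRing.isLinear.Build _ _ _ _ L (dot_is_linear c).
pose df : {linear 'rV[R]_m -> R} := HB.pack L dfM.
have dfc : continuous df by exact: dot_continuous.
have E : g \o shift x = cst (g x) + df +o_ (0 : 'rV[R]_m) id.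
  apply/eqaddoP => e e0.
  (* Each of the m coordinates will contribute an error of at most d * |h|;
     dividing by m.+1 rather than m keeps d positive when m = 0. *)
  pose d := e / m.+1%:R.
  have d0 : 0 < d by rewrite divr_gt0.
  have near_c : \forall z \near x, forall j : 'I_m,
      `|c j - 'D_(delta_mx 0 j) g z| <= d.
    suff near_j j : \forall z \near x, `|c j - 'D_(delta_mx 0 j) g z| <= d.
      exact: (@filter_forall _ _ _ _ (nbhs_filter x) near_j).
    by move/cvgrPdist_le : (cg j); exact.
  move/nbhs_ballP : near_c => [r /= r0 xr].
  apply/nbhs_ballP; exists r => //= h; rewrite -ball_normE /= sub0r normrN => hr.
  have -> : (g \o shift x - (cst (g x) + df)) h =
      \sum_(j < m) (g (x + prefix_row j.+1 h) - g (x + prefix_row j h)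
                    - h 0 j * c j).
    rewrite sumrB -(big_mkord predT (fun j => g (x + prefix_row j.+1 h) -
      g (x + prefix_row j h))) telescope_sumr// prefix_row0 prefix_row_full.
    by rewrite addr0 -addrA -opprD [x + h]addrC.
  have le_d (j : 'I_m) : `|g (x + prefix_row j.+1 h) - g (x + prefix_row j h)
      - h 0 j * c j| <= d * `|h|.
    rewrite prefix_rowS addrA.
    have [a aj ->] := derive_mvt g (x + prefix_row j h) _ (h 0 j) (dg j).
    rewrite -mulrBr normrM mulrC ler_pM ?norm_coord_le// distrC.
    apply: xr; rewrite -ball_normE /= -addrA opprD addNKr normrN.
    exact: le_lt_trans (norm_prefix_row _ _ _ aj) hr.
  apply: le_trans (ler_norm_sum _ _ _) _.
  apply: le_trans (ler_sum _ (fun j _ => le_d j)) _.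
  rewrite sumr_const card_ord -mulrnAl ler_wpM2r//.
  rewrite -mulr_natr /d -mulrA ler_piMr ?(ltW e0)//.
  by rewrite mulrC ler_pdivrMr// mul1r ler_nat.
by apply/diff_locallyP; rewrite (diff_unique dfc E).
Qed.

Lemma differentiable_rV {R : realType} {m n : nat} (f : 'rV[R]_m -> 'rV[R]_n)
    (x : 'rV[R]_m) :
  (forall i, differentiable (component f i) x) -> differentiable f x.
Proof.
move=> df.
have -> : f = \sum_(i < n) (fun z => component f i z *: delta_mx 0 i).
  by apply/funext => z; rewrite fct_sumE; exact: row_sum_delta.
by apply: differentiable_sum => i; exact: differentiableZl.
Qed.

Lemma continuous_partials_differentiable {R : realType} {m n : nat}
    (f : 'rV[R]_m -> 'rV[R]_n) :
  continuous_partials f -> forall x, differentiable f x.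
Proof.
move=> Cf x; apply: differentiable_rV => i.
by apply: differentiable_of_partials => j;
  have [d c] := Cf i j; [exact: d|exact: c].
Qed.

(** * Chain rule and iterates *)

(** Jacobians act on row vectors from the right, so the inner map comes first
    in the product. *)
Lemma jacobian_comp {R : realType} {m n p : nat} (f : 'rV[R]_m -> 'rV[R]_n)
    (g : 'rV[R]_n -> 'rV[R]_p) (x : 'rV[R]_m) :
  differentiable f x -> differentiable g (f x) ->
  'J (g \o f) x = 'J f x *m 'J g (f x).
Proof.
move=> df dg; apply/row_matrixP => i.
by rewrite row_mul !rowE /jacobian !mul_rV_lin1 diff_comp.
Qed.

Lemma det_jacobian_comp {R : realType} {k : nat} (f g : 'rV[R]_k -> 'rV[R]_k)
    (x : 'rV[R]_k) :
  differentiable f x -> differentiable g (f x) ->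
  \det ('J (g \o f) x) = \det ('J f x) * \det ('J g (f x)).
Proof. by move=> df dg; rewrite jacobian_comp// det_mulmx. Qed.

Lemma differentiable_iter {R : realType} {V : normedModType R} (f : V -> V)
    (n : nat) :
  (forall x, differentiable f x) -> forall x, differentiable (iter n f) x.
Proof.
move=> df; elim: n => [|n IHn] x; first exact: (@ex_diff _ _ _ _ _ id id).
exact: (differentiable_comp (g := f)).
Qed.

Theorem corollary4p3 (R : realType) (k : nat) (hk : (0 < k)%N)
    (psi : 'rV[R]_k -> 'rV[R]_k) (hpsi : continuous_partials psi)
    (X : 'rV[R]_k) (hX : \det ('J psi X) = 0) :
  forall n : nat, (0 < n)%N -> det_jacobian_root (iter n psi) X.
Proof.
have dpsi := continuous_partials_differentiable psi hpsi.
case=> [|n] n_gt0; first by rewrite ltnn in n_gt0.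
split; first exact: differentiable_iter.
have -> : iter n.+1 psi = iter n psi \o psi by apply/funext => x; exact: iterSr.
have dn := differentiable_iter psi n dpsi (psi X).
apply: etrans (det_jacobian_comp _ _ _ (dpsi X) dn) _.
exact: etrans (congr1 (fun d => d * _) hX) (mul0r _).
Qed.
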